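(* Let $L\in\mathbb{N}_0$ and let $\vec F\colon \mathrm{SO}(3)\to T\mathrm{SO}(3)$ be a vector field with representations $$\vec F = F_{l,x}\,\partial^{L}_{x} + F_{l,y}\,\partial^{L}_{y} + F_{l,z}\,\partial^{L}_{z} = F_{r,x}\,\partial^{R}_{x} + F_{r,y}\,\partial^{R}_{y} + F_{r,z}\,\partial^{R}_{z}$$ with respect to the left-invariant frame $(\partial^L_x,\partial^L_y,\partial^L_z)$ and the right-invariant frame $(\partial^R_x,\partial^R_y,\partial^R_z)$. If the component functions $F_{l,x},F_{l,y},F_{l,z}$ are $L$-band-limited, then $F_{r,x},F_{r,y},F_{r,z}$ are $(L+1)$-band-limited. Conversely, if $F_{r,x},F_{r,y},F_{r,z}$ are $L$-band-limited, then $F_{l,x},F_{l,y},F_{l,z}$ are $(L+1)$-band-limited.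
   Context: The tangent space of $\mathrm{SO}(3)$ at $R$ is $T_R\mathrm{SO}(3)=R\cdot\mathfrak{so}(3)=\mathfrak{so}(3)\cdot R$, where $\mathfrak{so}(3)$ is the space of real skew-symmetric $3\times3$ matrices. A vector field assigns to each $R$ an element $\vec F(R)\in T_R\mathrm{SO}(3)$. Put $$e_x=\begin{pmatrix}0&0&0\\0&0&-1\\0&1&0\end{pmatrix},\quad e_y=\begin{pmatrix}0&0&1\\0&0&0\\-1&0&0\end{pmatrix},\quad e_z=\begin{pmatrix}0&-1&0\\1&0&0\\0&0&0\end{pmatrix}.$$ The left-invariant frame is $\partial^L_x(R)=R e_x$, $\partial^L_y(R)=R e_y$, $\partial^L_z(R)=R e_z$; the right-invariant frame is $\partial^R_x(R)=e_xR$, $\partial^R_y(R)=e_yR$, $\partial^R_z(R)=e_zR$. Euler angles: $R(\alpha,\beta,\gamma)=R_z(\alpha)R_y(\beta)R_z(\gamma)$ with $\alpha,\gamma\in\mathbb{R}/2\pi\mathbb{Z}$, $\beta\in[0,\pi]$, where $R_z(t)=\exp(te_z)$ and $R_y(t)=\exp(te_y)$. For $l\in\mathbb{N}_0$ and integers $|k|,|k'|\le l$, the Wigner-d function $d_l^{k,k'}\colon[-1,1]\to\mathbb{R}$ is $$d_l^{k,k'}(x)=(-1)^{\nu}\binom{2l-s}{s+a}^{1/2}\binom{s+b}{b}^{-1/2}\left(\frac{1-x}{2}\right)^{a/2}\left(\frac{1+x}{2}\right)^{b/2}P_s^{a,b}(x),$$ with $a=|k-k'|$, $b=|k+k'|$,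 $s=l-\max\{|k|,|k'|\}$, $\nu=k+k'$ if $k>k'$ and $\nu=0$ otherwise, and $P_s^{a,b}$ the Jacobi polynomial of degree $s$ with parameters $a,b$ (normalized by $P_s^{a,b}(1)=\binom{s+a}{s}$). The Wigner-D function is $D_l^{k,k'}(R(\alpha,\beta,\gamma))=\sqrt{2l+1}\,e^{-ik\alpha}d_l^{k,k'}(\cos\beta)e^{-ik'\gamma}$. A function on $\mathrm{SO}(3)$ is called $L$-band-limited if it lies in $\Pi_L(\mathrm{SO}(3))=\mathrm{span}_{\mathbb{C}}\{D_l^{k,k'} : 0\le l\le L,\ -l\le k,k'\le l\}$. *)

(* Defs.v *)
From HB Require Import structures.
From mathcomp Require Import all_boot all_order all_algebra.
From mathcomp Require Import complex ring lra.
From mathcomp Require Import all_classical all_reals all_analysis.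

Set Implicit Arguments.
Unset Strict Implicit.
Unset Printing Implicit Defensive.

Import Order.TTheory GRing.Theory Num.Theory.
Import numFieldNormedType.Exports.
Local Open Scope classical_set_scope.
Local Open Scope ring_scope.
Local Open Scope complex_scope.

Definition mx_of_seq (R : realType) (rows : seq (seq R)) : 'M[R]_3 :=
  \matrix_(i < 3, j < 3) nth 0 (nth [::] rows i) j.

Definition e_x (R : realType) : 'M[R]_3 :=
  mx_of_seq [:: [:: 0; 0; 0]; [:: 0; 0; -1]; [:: 0; 1; 0]].
Definition e_y (R : realType) : 'M[R]_3 :=
  mx_of_seq [:: [:: 0; 0; 1]; [:: 0; 0; 0]; [:: -1; 0; 0]].
Definition e_z (R : realType) : 'M[R]_3 :=
  mx_of_seq [:: [:: 0; -1; 0]; [:: 1; 0; 0]; [:: 0; 0; 0]].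

Definition is_SO3 (R : realType) (A : 'M[R]_3) : bool :=
  (A^T *m A == 1%:M) && (\det A == 1).

Record SO3 (R : realType) := MkSO3 {
  SO3_mx :> 'M[R]_3;
  SO3_mxP : is_SO3 SO3_mx }.

Definition so3 (R : realType) : set 'M[R]_3 := [set X | X^T = - X].
Arguments so3 : clear implicits.

Definition tangent_SO3 (R : realType) (g : SO3 R) : set 'M[R]_3 :=
  [set g *m X | X in so3 R].

Definition vector_field (R : realType) (F : SO3 R -> 'M[R]_3) : Prop :=
  forall g, tangent_SO3 g (F g).

Definition dL_x (R : realType) (g : SO3 R) : 'M[R]_3 := g *m e_x R.
Definition dL_y (R : realType) (g : SO3 R) : 'M[R]_3 := g *m e_y R.
Definition dL_z (R : realType) (g : SO3 R) : 'M[R]_3 := g *m e_z R.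

Definition dR_x (R : realType) (g : SO3 R) : 'M[R]_3 := e_x R *m g.
Definition dR_y (R : realType) (g : SO3 R) : 'M[R]_3 := e_y R *m g.
Definition dR_z (R : realType) (g : SO3 R) : 'M[R]_3 := e_z R *m g.

Definition expmx (R : realType) (A : 'M[R]_3) : 'M[R]_3 :=
  lim (series (fun n : nat => (n`!%:R)^-1 *: A ^+ n) @ \oo).

Definition rot_z (R : realType) (t : R) : 'M[R]_3 := expmx (t *: e_z R).
Definition rot_y (R : realType) (t : R) : 'M[R]_3 := expmx (t *: e_y R).

Definition euler (R : realType) (alpha beta gamma : R) : 'M[R]_3 :=
  rot_z alpha *m rot_y beta *m rot_z gamma.

(* The angles alpha and gamma are represented by arbitrary reals, since all
   the functions of them used below are 2 pi-periodic. *)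
Definition is_euler_angles (R : realType) (g : SO3 R) : set (R * R * R) :=
  [set p | 0 <= p.1.2 <= pi /\ g = euler p.1.1 p.1.2 p.2 :> 'M[R]_3].

(* Szego, Orthogonal Polynomials, (4.3.2), for integer parameters *)
Definition jacobi (R : realType) (s a b : nat) : {poly R} :=
  \sum_(m < s.+1) ('C(s + a, s - m) * 'C(s + b, m))%:R *:
    ((2^-1 *: ('X - 1)) ^+ m * (2^-1 *: ('X + 1)) ^+ (s - m)).

Definition wignerd (R : realType) (l : nat) (k k' : int) (x : R) : R :=
  let a := absz (k - k') in
  let b := absz (k + k') in
  let s := (l - maxn (absz k) (absz k'))%N in
  let nu : int := if k' < k then k + k' else 0 in
  (-1) ^ nu * Num.sqrt 'C(2 * l - s, s + a)%:R * (Num.sqrt 'C(s + b, b)%:R)^-1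
  * ((1 - x) / 2) `^ (a%:R / 2) * ((1 + x) / 2) `^ (b%:R / 2)
  * (jacobi R s a b).[x].

(* expi t = e^{i t} *)
Definition expi (R : realType) (t : R) : R[i] := cos t +i* sin t.

Definition wignerD_angles (R : realType) (l : nat) (k k' : int)
    (alpha beta gamma : R) : R[i] :=
  (Num.sqrt (2 * l + 1)%:R)%:C * expi (- (k%:~R * alpha))
  * (wignerd l k k' (cos beta))%:C * expi (- (k'%:~R * gamma)).

(* The value does not depend on the Euler angles that are picked: see
   is_euler_angles_ex and wignerDE. *)
Definition wignerD (R : realType) (l : nat) (k k' : int) (g : SO3 R) : R[i] :=
  let p := xget (0, 0, 0) (is_euler_angles g) in
  wignerD_angles l k k' p.1.1 p.1.2 p.2.

(* The integers -l, ..., l are enumerated as i - l for 0 <= i <= 2 l. *)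
Definition bandlimited (R : realType) (L : nat) (f : SO3 R -> R[i]) : Prop :=
  exists c : nat -> int -> int -> R[i], forall g,
    f g = \sum_(l < L.+1) \sum_(i < (2 * l).+1) \sum_(j < (2 * l).+1)
      let k : int := i%:Z - l%:Z in let k' : int := j%:Z - l%:Z in
      c l k k' * wignerD l k k' g.

Definition bandlimited_real (R : realType) (L : nat) (f : SO3 R -> R) : Prop :=
  bandlimited L (fun g => (f g)%:C).

Lemma cvg_mx (R : realType) (m n : nat) (u : nat -> 'M[R]_(m, n))
    (M : 'M[R]_(m, n)) :
  (forall i j, (fun k => u k i j) @ \oo --> M i j) -> u @ \oo --> M.
Proof.
move=> h A [P hP hA].
have : \forall k \near \oo, forall i j, P i j (u k i j).
  apply: filter_forall => i; apply: filter_forall => j.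
  exact: (h i j _ (hP i j)).
by apply: filterS => k hk; apply: hA.
Qed.

Lemma expmx_coord (R : realType) (A : 'M[R]_3) (u : nat -> seq (seq R))
    (B : seq (seq R)) :
  (forall n, A ^+ n = mx_of_seq (u n)) ->
  (forall i j, (i < 3)%N -> (j < 3)%N ->
    series (fun n => (n`!%:R)^-1 * nth 0 (nth [::] (u n) i) j) @ \oo
      --> nth 0 (nth [::] B i) j) ->
  expmx A = mx_of_seq B.
Proof.
move=> Au h; apply/cvg_lim => //; apply: cvg_mx => i j; rewrite mxE.
rewrite [X in X @ \oo](_ : _ =
  series (fun n => (n`!%:R)^-1 * nth 0 (nth [::] (u n) i) j)); first exact: h.
apply/funext => n; rewrite /series/= summxE.
by apply: eq_bigr => k _; rewrite Au !mxE.
Qed.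

Lemma cvg_series_scos (R : realType) (t : R) :
  series (fun n => (n`!%:R)^-1 * ((~~ odd n)%:R * (-1) ^+ n./2 * t ^+ n)) @ \oo
    --> cos t.
Proof.
rewrite [X in series X](_ : _ = cos_coeff t).
  by rewrite unlock; exact: is_cvg_series_cos_coeff.
by apply/funext => n; rewrite /cos_coeff/= mulrC.
Qed.

Lemma cvg_series_ssin (R : realType) (t : R) :
  series (fun n => (n`!%:R)^-1 * ((odd n)%:R * (-1) ^+ n.-1./2 * t ^+ n)) @ \oo
    --> sin t.
Proof.
rewrite [X in series X](_ : _ = sin_coeff t).
  by rewrite unlock; exact: is_cvg_series_sin_coeff.
by apply/funext => n; rewrite /sin_coeff/= mulrC.
Qed.

Lemma cvg_series_sNsin (R : realType) (t : R) :
  series (fun n => (n`!%:R)^-1 * (- ((odd n)%:R * (-1) ^+ n.-1./2 * t ^+ n)))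
    @ \oo --> - sin t.
Proof.
rewrite [X in series X](_ : _ = - (fun n => (n`!%:R)^-1 *
    ((odd n)%:R * (-1) ^+ n.-1./2 * t ^+ n))).
  rewrite seriesN; apply: cvgN; exact: cvg_series_ssin.
by apply/funext => n; rewrite mulrN.
Qed.

Lemma cvg_series_s0 (R : realType) :
  series (fun n : nat => (n`!%:R)^-1 * (0 : R)) @ \oo --> (0 : R).
Proof.
rewrite [X in X @ \oo](_ : _ = cst 0); first exact: cvg_cst.
by apply/funext => n; rewrite /series/= big1// => i _; rewrite mulr0.
Qed.

Lemma cvg_series_s1 (R : realType) :
  series (fun n : nat => (n`!%:R)^-1 * ((n == 0%N)%:R : R)) @ \oo --> (1 : R).
Proof.
rewrite -cvg_shiftS.
rewrite [X in X @ \oo](_ : _ = cst 1); first exact: cvg_cst.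
apply/funext => n; rewrite /series/= big_nat_recl//= fact0 invr1 mulr1.
by rewrite big1 ?addr0// => i _; rewrite mulr0.
Qed.

Lemma scosS (R : realType) (t : R) (n : nat) :
  (~~ odd n.+1)%:R * (-1) ^+ n.+1./2 * t ^+ n.+1
  = - ((odd n)%:R * (-1) ^+ n.-1./2 * t ^+ n) * t.
Proof.
case: n => [|n]; rewrite /= ?negbK; first by rewrite !mul0r oppr0 mul0r.
by rewrite !exprS; ring.
Qed.

Lemma ssinS (R : realType) (t : R) (n : nat) :
  (odd n.+1)%:R * (-1) ^+ n.+1.-1./2 * t ^+ n.+1
  = (~~ odd n)%:R * (-1) ^+ n./2 * t ^+ n * t.
Proof. by rewrite /= exprS; ring. Qed.

Lemma rot_zE (R : realType) (t : R) : rot_z t =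
  mx_of_seq [:: [:: cos t; - sin t; 0]; [:: sin t; cos t; 0]; [:: 0; 0; 1]].
Proof.
pose C n : R := (~~ odd n)%:R * (-1) ^+ n./2 * t ^+ n.
pose S n : R := (odd n)%:R * (-1) ^+ n.-1./2 * t ^+ n.
have pw n : (t *: e_z R) ^+ n = mx_of_seq
    [:: [:: C n; - S n; 0]; [:: S n; C n; 0]; [:: 0; 0; (n == 0%N)%:R]].
  elim: n => [|n IHn].
    apply/matrixP; case=> [[|[|[|//]]] ?] [[|[|[|//]]] ?];
      rewrite expr0 !mxE/= /C /S /= ?expr0 ?mul1r ?mul0r ?oppr0//.
  rewrite exprSr IHn {IHn} /C /S !scosS !ssinS; apply/matrixP.
  by case=> [[|[|[|//]]] ?] [[|[|[|//]]] ?];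
    rewrite !mxE !big_ord_recr big_ord0/= !mxE/=; ring.
apply: (expmx_coord pw) => [[|[|[|//]]]] [|[|[|//]]] _ _ /=.
all: by [exact: cvg_series_scos | exact: cvg_series_ssin
  | exact: cvg_series_sNsin | exact: cvg_series_s0 | exact: cvg_series_s1].
Qed.

Lemma rot_yE (R : realType) (t : R) : rot_y t =
  mx_of_seq [:: [:: cos t; 0; sin t]; [:: 0; 1; 0]; [:: - sin t; 0; cos t]].
Proof.
pose C n : R := (~~ odd n)%:R * (-1) ^+ n./2 * t ^+ n.
pose S n : R := (odd n)%:R * (-1) ^+ n.-1./2 * t ^+ n.
have pw n : (t *: e_y R) ^+ n = mx_of_seq
    [:: [:: C n; 0; S n]; [:: 0; (n == 0%N)%:R; 0]; [:: - S n; 0; C n]].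
  elim: n => [|n IHn].
    apply/matrixP; case=> [[|[|[|//]]] ?] [[|[|[|//]]] ?];
      rewrite expr0 !mxE/= /C /S /= ?expr0 ?mul1r ?mul0r ?oppr0//.
  rewrite exprSr IHn {IHn} /C /S !scosS !ssinS; apply/matrixP.
  by case=> [[|[|[|//]]] ?] [[|[|[|//]]] ?];
    rewrite !mxE !big_ord_recr big_ord0/= !mxE/=; ring.
apply: (expmx_coord pw) => [[|[|[|//]]]] [|[|[|//]]] _ _ /=.
all: by [exact: cvg_series_scos | exact: cvg_series_ssin
  | exact: cvg_series_sNsin | exact: cvg_series_s0 | exact: cvg_series_s1].
Qed.

Lemma jacobi1 (R : realType) (s a b : nat) :
  (jacobi R s a b).[1] = 'C(s + a, s)%:R.
Proof.
rewrite /jacobi horner_sum big_ord_recl/= big1 => [|i _].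
  rewrite !hornerE subn0 bin0 muln1.
  rewrite (_ : 2^-1 * (1 + 1) = 1); last by field.
  by rewrite !(expr1n, expr0) /= !mulr1.
by rewrite !hornerE subrr mulr0 expr0n/= !(mul0r, mulr0).
Qed.

Lemma eulerE (R : realType) (a b c : R) : euler a b c = mx_of_seq
  [:: [:: cos a * cos b * cos c - sin a * sin c;
          - (cos a * cos b * sin c) - sin a * cos c; cos a * sin b];
      [:: sin a * cos b * cos c + cos a * sin c;
          cos a * cos c - sin a * cos b * sin c; sin a * sin b];
      [:: - (sin b * cos c); sin b * sin c; cos b]].
Proof.
rewrite /euler !rot_zE rot_yE; apply/matrixP.
by case=> [[|[|[|//]]] ?] [[|[|[|//]]] ?];
  rewrite !mxE !big_ord_recr big_ord0/= !mxE !big_ord_recr !big_ord0/= !mxE/=;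
  ring.
Qed.

Lemma sin_unique (R : realType) (b b' : R) :
  0 <= b <= pi -> 0 <= b' <= pi -> cos b = cos b' -> sin b = sin b'.
Proof.
move=> hb hb' e.
have := sin2cos2 b; rewrite e -sin2cos2 => /eqP.
by rewrite eqrXn2 ?sin_ge0_pi// => /eqP.
Qed.

Lemma expiD (R : realType) (t u : R) : expi (t + u) = expi t * expi u.
Proof.
rewrite /expi cosD sinD; apply/eqP; rewrite eq_complex/=.
by apply/andP; split; apply/eqP; ring.
Qed.

Lemma expi_mulz (R : realType) (k : int) (t t' : R) :
  expi t = expi t' -> expi (- (k%:~R * t)) = expi (- (k%:~R * t')).
Proof.
move=> e.
have en (n : nat) : expi (n%:R * t) = expi (n%:R * t').
  elim: n => [|n IHn]; first by rewrite !mul0r.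
  by rewrite -!natr1 !mulrDl !mul1r !expiD IHn e.
have eN (u v : R) : expi u = expi v -> expi (- u) = expi (- v).
  by rewrite /expi !cosN !sinN => -[-> ->].
case: k => n; first by rewrite -!pmulrn; exact/eN/en.
by rewrite NegzE !mulrNz !mulNr !opprK -!pmulrn; exact: en.
Qed.

Lemma wignerd_eq0_1 (R : realType) (l : nat) (k k' : int) :
  k != k' -> wignerd l k k' (1 : R) = 0.
Proof.
move=> kk'; rewrite /wignerd subrr mul0r powR0 ?(mulr0, mul0r)//.
by rewrite mulf_neq0// ?invr_neq0// ?pnatr_eq0// absz_eq0 subr_eq0.
Qed.

Lemma wignerd_eq0_N1 (R : realType) (l : nat) (k k' : int) :
  k != - k' -> wignerd l k k' (-1 : R) = 0.
Proof.
move=> kk'; rewrite /wignerd addrN mul0r (@powR0 _ (_%:R / _)) ?(mulr0, mul0r)//.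
by rewrite mulf_neq0// ?invr_neq0// ?pnatr_eq0// absz_eq0 addr_eq0.
Qed.

Lemma wignerD_angles_unique (R : realType) (l : nat) (k k' : int)
    (a b c a' b' c' : R) :
  0 <= b <= pi -> 0 <= b' <= pi -> euler a b c = euler a' b' c' ->
  wignerD_angles l k k' a b c = wignerD_angles l k k' a' b' c'.
Proof.
move=> hb hb'; rewrite !eulerE => /matrixP e.
have E (i j : nat) (hi : (i < 3)%N) (hj : (j < 3)%N) :
    _ := e (Ordinal hi) (Ordinal hj).
move: (E 0 0 isT isT) (E 1 0 isT isT)%N (E 0 2 isT isT)%N (E 1 2 isT isT)%N
  (E 2 0 isT isT)%N (E 2 1 isT isT)%N (E 2 2 isT isT)%N.
rewrite !mxE/= {e E} => e00 e10 e02 e12 e20 e21 e22.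
have es := sin_unique hb hb' e22.
rewrite /wignerD_angles -e22.
have [sb0|sb0] := eqVneq (sin b) 0; last first.
  have ca : cos a = cos a' by apply: (mulIf sb0); rewrite e02 es.
  have sa : sin a = sin a' by apply: (mulIf sb0); rewrite e12 es.
  have cc : cos c = cos c'.
    by apply: (mulfI sb0); apply: oppr_inj; rewrite e20 es.
  have sc : sin c = sin c' by apply: (mulfI sb0); rewrite e21 es.
  rewrite (@expi_mulz _ k a a') ?(@expi_mulz _ k' c c')//.
    by rewrite /expi cc sc.
  by rewrite /expi ca sa.
have re (x y z w : R[i]) : x * y * z * w = x * z * (y * w).
  by rewrite -!mulrA (mulrCA y).
have : (cos b - 1) * (cos b + 1) = 0.
  by rewrite -subr_sqr expr1n cos2sin2 sb0; ring.
move/eqP; rewrite mulf_eq0 subr_eq0 addr_eq0 => /orP[]/eqP cb.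
  rewrite cb; have [kk'|kk'] := eqVneq k k'; last first.
    by rewrite wignerd_eq0_1// rmorph0 !(mulr0, mul0r).
  rewrite -kk' [LHS]re [RHS]re -!expiD.
  rewrite -!opprD -!mulrDr (@expi_mulz _ k (a + c) (a' + c'))//.
  move: e00 e10; rewrite -e22 cb !mulr1 -!cosD => e00.
  by rewrite -!sinD /expi e00 => ->.
rewrite cb; have [kk'|kk'] := eqVneq k (- k'); last first.
  by rewrite wignerd_eq0_N1// rmorph0 !(mulr0, mul0r).
have -> : k' = - k by rewrite kk' opprK.
rewrite mulrNz !mulNr !opprK [LHS]re [RHS]re -!expiD.
have ac (x y : R) : - (k%:~R * x) + k%:~R * y = - (k%:~R * (x - y)) by ring.
rewrite !ac (@expi_mulz _ k (a - c) (a' - c'))//.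
move: e00 e10; rewrite -e22 cb /expi cosB sinB cosB sinB => e00 e10.
by congr (_ +i* _); apply: oppr_inj; lra.
Qed.

Lemma wignerDE (R : realType) (l : nat) (k k' : int) (g : SO3 R) (a b c : R) :
  0 <= b <= pi -> g = euler a b c :> 'M[R]_3 ->
  wignerD l k k' g = wignerD_angles l k k' a b c.
Proof.
move=> hb hg; rewrite /wignerD.
case: (@xgetP _ (0, 0, 0) (is_euler_angles g)) => [[[a' b'] c'] -> [/= hb' hg']|].
  exact: wignerD_angles_unique hb' hb (etrans (esym hg') hg).
by move/(_ (a, b, c)); case; split.
Qed.

Lemma unit_circle (R : realType) (x y : R) :
  x ^+ 2 + y ^+ 2 = 1 -> exists t, cos t = x /\ sin t = y.
Proof.
move=> xy1; have x1 : -1 <= x <= 1.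
  by rewrite -ler_norml -(@expr_le1 _ 2)// real_normK ?num_real// -xy1 lerDl sqr_ge0.
have sx : sin (acos x) = `|y|.
  by rewrite sin_acos// -xy1 addrAC subrr add0r sqrtr_sqr.
have cx : cos (acos x) = x by apply: acosK; rewrite in_itv.
have [y0|y0] := leP 0 y.
  by exists (acos x); rewrite cx sx ger0_norm.
by exists (- acos x); rewrite cosN sinN cx sx ltr0_norm// opprK.
Qed.

Lemma det_mx3 (R : realType) (A : 'M[R]_3) (a : nat -> nat -> R) :
  (forall i j : 'I_3, A i j = a i j) ->
  \det A = a 0 0 * (a 1 1 * a 2 2 - a 1 2 * a 2 1)
         - a 0 1 * (a 1 0 * a 2 2 - a 1 2 * a 2 0)
         + a 0 2 * (a 1 0 * a 2 1 - a 1 1 * a 2 0).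
Proof.
move=> E; rewrite (expand_det_row _ ord0) !big_ord_recr big_ord0/= /cofactor.
rewrite !(expand_det_row _ ord0) !big_ord_recr !big_ord0/= /cofactor !det_mx11.
by rewrite !mxE/= !E/= /bump/=; ring.
Qed.

Lemma is_SO3M (R : realType) (A B : 'M[R]_3) :
  is_SO3 A -> is_SO3 B -> is_SO3 (A *m B).
Proof.
move=> /andP[/eqP A1 /eqP Ad] /andP[/eqP B1 /eqP Bd]; apply/andP; split.
  by rewrite trmx_mul mulmxA -(mulmxA B^T) A1 mulmx1 B1.
by rewrite det_mulmx Ad Bd mulr1.
Qed.

Lemma is_SO3V (R : realType) (A : 'M[R]_3) : is_SO3 A -> is_SO3 A^T.
Proof.
move=> /andP[/eqP A1 /eqP Ad]; apply/andP; split.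
  by rewrite trmxK; apply/eqP/mulmx1C.
by rewrite det_tr Ad.
Qed.

Lemma rot_z_SO3 (R : realType) (t : R) : is_SO3 (rot_z t).
Proof.
have ct := cos2Dsin2 t; rewrite rot_zE; apply/andP; split; apply/eqP.
  apply/matrixP; case=> [[|[|[|//]]] ?] [[|[|[|//]]] ?];
  rewrite !mxE !big_ord_recr big_ord0/= !mxE/=; try ring; rewrite -ct; ring.
rewrite (@det_mx3 _ _ (fun i j => nth 0 (nth [::] [:: [:: cos t; - sin t; 0];
  [:: sin t; cos t; 0]; [:: 0; 0; 1]] i) j)) /=; first by rewrite -[RHS]ct; ring.
by move=> i j; rewrite mxE.
Qed.

Lemma rot_y_SO3 (R : realType) (t : R) : is_SO3 (rot_y t).
Proof.
have ct := cos2Dsin2 t; rewrite rot_yE; apply/andP; split; apply/eqP.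
  apply/matrixP; case=> [[|[|[|//]]] ?] [[|[|[|//]]] ?];
  rewrite !mxE !big_ord_recr big_ord0/= !mxE/=; try ring; rewrite -ct; ring.
rewrite (@det_mx3 _ _ (fun i j => nth 0 (nth [::] [:: [:: cos t; 0; sin t];
  [:: 0; 1; 0]; [:: - sin t; 0; cos t]] i) j)) /=; first by rewrite -[RHS]ct; ring.
by move=> i j; rewrite mxE.
Qed.

Lemma euler_SO3 (R : realType) (a b c : R) : is_SO3 (euler a b c).
Proof.
by apply: is_SO3M (rot_z_SO3 c); apply: is_SO3M (rot_z_SO3 a) (rot_y_SO3 b).
Qed.

Lemma spherical (R : realType) (x y z : R) : x ^+ 2 + y ^+ 2 + z ^+ 2 = 1 ->
  exists a b, [/\ 0 <= b <= pi, x = cos a * sin b, y = sin a * sin b & z = cos b].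
Proof.
move=> xyz; have z1 : -1 <= z <= 1.
  rewrite -ler_norml -(@expr_le1 _ 2)// real_normK ?num_real// -xyz.
  by rewrite lerDr addr_ge0 ?sqr_ge0.
have [hb cb] := acos_def z1; set b := acos z in hb cb.
have s2 : sin b ^+ 2 = x ^+ 2 + y ^+ 2 by rewrite sin2cos2 cb -xyz; ring.
have [sb0|sb0] := eqVneq (sin b) 0.
  have /eqP : x ^+ 2 + y ^+ 2 = 0 by rewrite -s2 sb0 expr0n.
  rewrite paddr_eq0 ?sqr_ge0// !sqrf_eq0 => /andP[/eqP x0 /eqP y0].
  by exists 0, b; rewrite sb0 x0 y0 !mulr0 cb.
have [a [ca sa]] : exists t, cos t = x / sin b /\ sin t = y / sin b.
  by apply: unit_circle; rewrite !expr_div_n -mulrDl -s2 divff// sqrf_eq0.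
by exists a, b; rewrite ca sa !divfK.
Qed.

Lemma is_SO3_rot_z (R : realType) (A : 'M[R]_3) : is_SO3 A ->
  A (inord 0) (inord 2) = 0 -> A (inord 1) (inord 2) = 0 ->
  A (inord 2) (inord 2) = 1 -> exists t, A = rot_z t.
Proof.
move=> AS; have /andP[/eqP /matrixP AtA /eqP Ad] := AS.
have /andP[/eqP /matrixP AAt _] := is_SO3V AS.
pose a (i j : nat) := A (inord i) (inord j).
have E (i j : 'I_3) : A i j = a i j by rewrite /a !inord_val.
move: Ad; rewrite (det_mx3 E) => Ad; rewrite -!/(a _ _) => a02 a12 a22.
have H (i j : nat) (hi : (i < 3)%N) (hj : (j < 3)%N) :
    a 0%N i * a 0%N j + a 1%N i * a 1%N j + a 2%N i * a 2%N j = (i == j)%:R.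
  have := AtA (Ordinal hi) (Ordinal hj).
  by rewrite !mxE !big_ord_recr big_ord0/= !mxE !E/= add0r.
have H' (i j : nat) (hi : (i < 3)%N) (hj : (j < 3)%N) :
    a i 0%N * a j 0%N + a i 1%N * a j 1%N + a i 2%N * a j 2%N = (i == j)%:R.
  have := AAt (Ordinal hi) (Ordinal hj).
  by rewrite !mxE !big_ord_recr big_ord0/= !mxE !E/= add0r.
have h22 := H' 2%N 2%N isT isT; rewrite a22 mulr1 /= in h22.
have /eqP : a 2%N 0%N ^+ 2 + a 2%N 1%N ^+ 2 = 0 by rewrite !expr2; lra.
rewrite paddr_eq0 ?sqr_ge0// !sqrf_eq0 => /andP[/eqP a20 /eqP a21].
have h00 := H 0%N 0%N isT isT; have h01 := H 0%N 1%N isT isT.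
move: Ad h00 h01; rewrite a02 a12 a22 a20 a21 /= => Ad h00 h01.
have [t [ct st]] : exists t, cos t = a 0%N 0%N /\ sin t = a 1%N 0%N.
  by apply: unit_circle; rewrite !expr2; lra.
set p := a 0%N 0%N in Ad h00 h01 ct; set q := a 1%N 0%N in Ad h00 h01 st.
have Ad' : p * a 1%N 1%N - a 0%N 1%N * q = 1 by lra.
have h01' : p * a 0%N 1%N + q * a 1%N 1%N = 0 by lra.
have pq1 : p * p + q * q = 1 by lra.
have a11 : a 1%N 1%N = p.
  transitivity (p * (p * a 1%N 1%N - a 0%N 1%N * q)
    + q * (p * a 0%N 1%N + q * a 1%N 1%N)); last by rewrite Ad' h01'; ring.
  transitivity ((p * p + q * q) * a 1%N 1%N); last by ring.
  by rewrite pq1 mul1r.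
have a01 : a 0%N 1%N = - q.
  transitivity (p * (p * a 0%N 1%N + q * a 1%N 1%N)
    - q * (p * a 1%N 1%N - a 0%N 1%N * q)); last by rewrite Ad' h01'; ring.
  transitivity ((p * p + q * q) * a 0%N 1%N); last by ring.
  by rewrite pq1 mul1r.
exists t; rewrite rot_zE; apply/matrixP.
by case=> [[|[|[|//]]] ?] [[|[|[|//]]] ?]; rewrite E mxE/= ?ct ?st.
Qed.

Lemma is_euler_angles_ex (R : realType) (g : SO3 R) : is_euler_angles g !=set0.
Proof.
case: g => g gS; have /andP[/eqP /matrixP gtg _] := gS.
have [a [b [hb g02 g12 g22]]] : exists a b, [/\ 0 <= b <= pi,
    g (inord 0) (inord 2) = cos a * sin b,
    g (inord 1) (inord 2) = sin a * sin b & g (inord 2) (inord 2) = cos b].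
  pose u (i j : nat) := g (inord i) (inord j).
  have E (i j : 'I_3) : g i j = u i j by rewrite /u !inord_val.
  apply: spherical; rewrite -!/(u _ _).
  have := gtg (@Ordinal 3 2 isT) (@Ordinal 3 2 isT).
  by rewrite !mxE !big_ord_recr big_ord0/= !mxE !E/= add0r !expr2.
pose Q := rot_z a *m rot_y b.
have QS : is_SO3 Q by exact: is_SO3M (rot_z_SO3 a) (rot_y_SO3 b).
have QtQ : Q *m Q^T = 1%:M.
  by have /andP[/eqP] := is_SO3V QS; rewrite trmxK.
have [c hc] : exists c, Q^T *m g = rot_z c.
  have ca := cos2Dsin2 a; have cb := cos2Dsin2 b.
  have S3 (u : 'I_3 -> R) :
      \sum_i u i = u (inord 0) + u (inord 1) + u (inord 2).
    rewrite !big_ord_recr big_ord0/= add0r.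
    by congr (u _ + u _ + u _); apply/val_inj; rewrite /= ?inordK.
  have QE (i j : 'I_3) : Q i j = nth 0 (nth [::]
      [:: [:: cos a * cos b; - sin a; cos a * sin b];
          [:: sin a * cos b; cos a; sin a * sin b];
          [:: - sin b; 0; cos b]] i) j.
    rewrite /Q rot_zE rot_yE.
    case: i j => [[|[|[|//]]] ?] [[|[|[|//]]] ?];
      rewrite !mxE !big_ord_recr big_ord0/= !mxE/=; ring.
  clearbody Q; apply: is_SO3_rot_z; first exact: is_SO3M (is_SO3V QS) gS.
  - rewrite !mxE S3 !mxE !QE !inordK//= g02 g12 g22.
    transitivity (cos b * sin b * (cos a ^+ 2 + sin a ^+ 2 - 1)); first ring.
    by rewrite ca subrr mulr0.
  - rewrite !mxE S3 !mxE !QE !inordK//= g02 g12 g22; ring.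
  - rewrite !mxE S3 !mxE !QE !inordK//= g02 g12 g22.
    transitivity (sin b ^+ 2 * (cos a ^+ 2 + sin a ^+ 2) + cos b ^+ 2).
      by ring.
    by rewrite ca mulr1 addrC.
exists (a, b, c); split => //=.
by rewrite /euler -/Q -hc mulmxA QtQ mul1mx.
Qed.

(* Main.v *)
(* Writing v, w for the component vectors in the left and right frames,
   g hat(v) = hat(w) g with g orthogonal of determinant 1 gives w = g v and
   v = g^T w. It remains to see that band limits add under products, the
   entries of g being 1-band-limited: the L-band-limited functions are exactly
   the span of e^{-ik alpha} e^{-ik' gamma} sin(beta/2)^|k-k'|
   cos(beta/2)^|k+k'| q(cos beta) with deg q + max(|k|,|k'|) <= L, and this
   description is visibly compatible with products. *)
Require Import Defs.
From HB Require Import structures.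
From mathcomp Require Import all_boot all_order all_algebra.
From mathcomp Require Import complex.
From mathcomp Require Import ring zify.
From mathcomp Require Import all_classical all_reals all_analysis.

Set Implicit Arguments.
Unset Strict Implicit.
Unset Printing Implicit Defensive.

Import Order.TTheory GRing.Theory Num.Theory.
Local Open Scope ring_scope.
Local Open Scope complex_scope.

(** * Skew matrices as vectors, and the change of frame *)

Definition hat (R : realType) (v : 'cV[R]_3) : 'M[R]_3 :=
  v (inord 0) 0 *: e_x R + v (inord 1) 0 *: e_y R + v (inord 2) 0 *: e_z R.

Lemma sum3E (V : nmodType) (u : 'I_3 -> V) :
  \sum_i u i = u (inord 0) + u (inord 1) + u (inord 2).
Proof.
rewrite !big_ord_recr big_ord0/= add0r.
by congr (u _ + u _ + u _); apply/val_inj; rewrite /= ?inordK.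
Qed.

(** As [hat v] is the matrix of the cross product with v, this is A^T (Av × Au) = det A · (v × u), a
    polynomial identity in the entries that holds for every A. *)
Lemma hat_conj (R : realType) (A : 'M[R]_3) (v : 'cV[R]_3) :
  A^T *m hat (A *m v) *m A = \det A *: hat v.
Proof.
pose a i j := A (inord i) (inord j); pose w i := v (inord i) 0.
have aE i j : A i j = a i j by rewrite /a !inord_val.
have wE i j : v i j = w i by rewrite /w inord_val ord1.
rewrite (@det_mx3 _ _ a aE); apply/matrixP => i j.
rewrite !mxE sum3E !mxE !sum3E !mxE !sum3E !wE !aE !inordK//.
by case: i j => [[|[|[|//]]] ?] [[|[|[|//]]] ?] /=; ring.
Qed.

Lemma hat_inj (R : realType) : injective (@hat R).
Proof.
move=> v w /matrixP e; apply/matrixP => i j; rewrite ord1.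
(* The entries +1 of [e_x], [e_y], [e_z] sit at these positions, so they read off the
   coordinates. *)
have := (e (inord 2) (inord 1), e (inord 0) (inord 2), e (inord 1) (inord 0)).
rewrite /hat !mxE !inordK//= !(mulr0, mulr1, addr0, add0r) => -[[e0 e1] e2].
by rewrite -(inord_val i); case: i => [[|[|[|//]]] ?].
Qed.

Lemma SO3_trmxK (R : realType) (g : SO3 R) : g *m g^T = 1%:M.
Proof. by case: g => g /= /andP[/eqP/mulmx1C]. Qed.

(** Multiplying by g^T gives hat v = g^T hat(w) g. Writing w = g (g^T w) and using det g = 1,
    [hat_conj] turns the right side into hat(g^T w). *)
Lemma frame_change (R : realType) (g : SO3 R) (v w : 'cV[R]_3) :
  g *m hat v = hat w *m g -> v = g^T *m w.
Proof.
have /andP[/eqP gtg /eqP dg] := SO3_mxP g.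
move=> e; apply: hat_inj; rewrite -[RHS]scale1r -dg -hat_conj.
by rewrite [g *m (_ *m _)]mulmxA SO3_trmxK mul1mx -mulmxA -e mulmxA gtg mul1mx.
Qed.

(** * Linear structure of the band-limited functions *)

Lemma bandlimited0 (R : realType) (L : nat) : bandlimited L (fun=> 0 : R[i]).
Proof.
exists (fun _ _ _ => 0) => g; rewrite big1// => l _.
by rewrite big1// => i _; rewrite big1// => j _; rewrite /= mul0r.
Qed.

Lemma bandlimitedD (R : realType) (L : nat) (f h : SO3 R -> R[i]) :
  bandlimited L f -> bandlimited L h -> bandlimited L (fun g => f g + h g).
Proof.
move=> [c fE] [d hE]; exists (fun l k k' => c l k k' + d l k k') => g.
rewrite fE hE -big_split; apply: eq_bigr => l _; rewrite -big_split.
apply: eq_bigr => i _; rewrite -big_split; apply: eq_bigr => j _.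
by rewrite /= mulrDl.
Qed.

Lemma bandlimitedZ (R : realType) (L : nat) (a : R[i]) (f : SO3 R -> R[i]) :
  bandlimited L f -> bandlimited L (fun g => a * f g).
Proof.
move=> [c fE]; exists (fun l k k' => a * c l k k') => g.
rewrite fE mulr_sumr; apply: eq_bigr => l _; rewrite mulr_sumr.
apply: eq_bigr => i _; rewrite mulr_sumr; apply: eq_bigr => j _.
by rewrite /= mulrA.
Qed.

Lemma bandlimited_wignerD (R : realType) (L l : nat) (k k' : int) :
  (maxn (absz k) (absz k') <= l <= L)%N -> bandlimited L (@wignerD R l k k').
Proof.
move=> /andP[kl lL].
exists (fun l1 k1 k1' => ((l1 == l) && (k1 == k) && (k1' == k'))%:R) => g.
(* k has index k + l in the enumeration of -l, ..., l, and |k| <= l puts it in range. *)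
have iP : (absz (k + l%:Z)%R < (2 * l).+1)%N by lia.
have jP : (absz (k' + l%:Z)%R < (2 * l).+1)%N by lia.
rewrite (bigD1 (Ordinal (n := L.+1) (m := l) lL))//=.
rewrite (bigD1 (Ordinal iP))//= (bigD1 (Ordinal jP))//=.
have -> : (absz (k + l%:Z))%:Z - l%:Z = k by lia.
have -> : (absz (k' + l%:Z))%:Z - l%:Z = k' by lia.
rewrite !eqxx mul1r !big1 ?addr0// => [l1|i|j] ne.
- rewrite big1// => i _; rewrite big1// => j _.
  by rewrite -val_eqE /= in ne; rewrite (negbTE ne) mul0r.
- rewrite big1// => j _; rewrite (_ : (_ - _ == k) = false) ?mul0r//.
  by apply/negP => /eqP e; move/eqP: ne; apply; apply/val_inj => /=; lia.
- rewrite (_ : (_ - _ == k') = false) ?andbF ?mul0r//.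
  by apply/negP => /eqP e; move/eqP: ne; apply; apply/val_inj => /=; lia.
Qed.

(** Span induction, which reduces the bilinear product rule below to single Wigner functions. *)
Lemma bandlimited_ind (R : realType) (L : nat) (P : (SO3 R -> R[i]) -> Prop) :
  P (fun=> 0) ->
  (forall f h, P f -> P h -> P (fun g => f g + h g)) ->
  (forall a f, P f -> P (fun g => a * f g)) ->
  (forall l k k', (maxn (absz k) (absz k') <= l <= L)%N -> P (@wignerD R l k k')) ->
  forall f, bandlimited L f -> P f.
Proof.
move=> P0 PD PZ PW f [c /funext ->].
have Psum n (G : 'I_n -> SO3 R -> R[i]) :
    (forall i, P (G i)) -> P (fun g => \sum_(i < n) G i g).
  move=> PG; elim: (index_enum _) => [|i r IH].
    by under eq_fun do rewrite big_nil.
  by under eq_fun do rewrite big_cons; exact: PD.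
apply: (Psum _ _) => l; apply: (Psum _ _) => i; apply: (Psum _ _) => j.
apply/PZ/PW; case: l i j => l /= lL [i /= iP] [j /= jP]; lia.
Qed.

(** * Modes, and their equivalence with Wigner functions *)

(* Square roots stand for sin(beta/2) and cos(beta/2), as 0 <= beta <= pi. *)
Definition mode (R : realType) (k k' : int) (q : {poly R}) (g : SO3 R) : R[i] :=
  let p := xget (0, 0, 0) (is_euler_angles g) in
  expi (- (k%:~R * p.1.1)) * expi (- (k'%:~R * p.2))
  * (Num.sqrt ((1 - cos p.1.2) / 2) ^+ absz (k - k')
     * Num.sqrt ((1 + cos p.1.2) / 2) ^+ absz (k + k') * q.[cos p.1.2])%:C.

Arguments mode : simpl never.

Lemma powR_half (R : realType) (x : R) (n : nat) :
  0 <= x -> x `^ (n%:R / 2) = Num.sqrt x ^+ n.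
Proof.
by move=> x0; rewrite mulrC powRrM powR12_sqrt// powR_mulrn// sqrtr_ge0.
Qed.

Lemma half1Bcos_ge0 (R : realType) (t : R) : 0 <= (1 - cos t) / 2.
Proof. by rewrite divr_ge0// subr_ge0 cos_le1. Qed.

Lemma half1Dcos_ge0 (R : realType) (t : R) : 0 <= (1 + cos t) / 2.
Proof. by rewrite divr_ge0// -lerBlDl add0r cos_geN1. Qed.

(** The scalar collects the normalizing factors; its being nonzero allows [bandlimited_mode] to
    solve for the mode. *)
Lemma wignerD_mode (R : realType) (l : nat) (k k' : int) :
  (maxn (absz k) (absz k') <= l)%N ->
  exists2 c : R[i], c != 0 & forall g, wignerD l k k' g = c *
    mode k k' (jacobi R (l - maxn (absz k) (absz k')) (absz (k - k'))
      (absz (k + k'))) g.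
Proof.
move=> kl; set s := (l - _)%N; set a := absz (k - k'); set b := absz (k + k').
pose nu : int := if k' < k then k + k' else 0.
have sqrtC_neq0 n m : (m <= n)%N -> Num.sqrt 'C(n, m)%:R != 0 :> R.
  by move=> mn; rewrite gt_eqF// sqrtr_gt0 ltr0n bin_gt0.
exists ((Num.sqrt (2 * l + 1)%:R)%:C * ((-1) ^ nu *
    Num.sqrt 'C(2 * l - s, s + a)%:R * (Num.sqrt 'C(s + b, b)%:R)^-1)%:C).
  apply: mulf_neq0; rewrite fmorph_eq0.
    by rewrite gt_eqF// sqrtr_gt0 ltr0n addn1.
  rewrite !mulf_neq0 ?invr_neq0 ?sqrtC_neq0 ?expfz_neq0 ?oppr_eq0 ?oner_eq0//.
    (* s + a <= 2l - s amounts to a <= 2 max(|k|,|k'|). *)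
    lia.
  exact: leq_addl.
move=> g; rewrite /wignerD /wignerD_angles /mode /wignerd -/s -/a -/b -/nu.
set p := xget _ _.
by rewrite !powR_half ?half1Bcos_ge0 ?half1Dcos_ge0// !rmorphM/=; ring.
Qed.

Lemma modeD (R : realType) (k k' : int) (q r : {poly R}) (g : SO3 R) :
  mode k k' (q + r) g = mode k k' q g + mode k k' r g.
Proof. by rewrite /mode hornerD [in LHS]mulrDr rmorphD mulrDr. Qed.

Lemma modeZ (R : realType) (k k' : int) (a : R) (q : {poly R}) (g : SO3 R) :
  mode k k' (a *: q) g = a%:C * mode k k' q g.
Proof. by rewrite /mode hornerZ !rmorphM/=; ring. Qed.

Lemma mode0 (R : realType) (k k' : int) : @mode R k k' 0 = fun=> 0.
Proof. by apply/funext => g; rewrite /mode horner0 !mulr0. Qed.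

(** Every summand is a nonnegative multiple of a monic polynomial of degree s, so the leading
    coefficients cannot cancel. *)
Lemma size_jacobi (R : realType) (s a b : nat) : size (jacobi R s a b) = s.+1.
Proof.
have e (c : R) : 2^-1 *: ('X + c%:P) = (2^-1)%:P * ('X - (- c)%:P).
  by rewrite mul_polyC polyCN opprK.
have E m : (m < s.+1)%N ->
    (2^-1 *: ('X - 1)) ^+ m * (2^-1 *: ('X + 1)) ^+ (s - m)
    = (2^-1 ^+ s) *: (('X - 1%:P) ^+ m * ('X - (-1)%:P) ^+ (s - m)) :> {poly R}.
  move=> ms; rewrite polyCN opprK !exprZn -scalerAl -scalerAr scalerA.
  by rewrite -exprD subnKC.
have szM m : (m < s.+1)%N ->
    size (('X - 1%:P) ^+ m * ('X - (-1)%:P) ^+ (s - m) : {poly R}) = s.+1.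
  move=> ms; rewrite size_Mmonic ?monic_exp ?monicXsubC//.
    by rewrite !size_exp_XsubC; lia.
  by rewrite monic_neq0// monic_exp// monicXsubC.
apply/eqP; rewrite eqn_leq; apply/andP; split.
  apply/leq_sizeP => n sn; rewrite coef_sum big1// => m _.
  by rewrite E// !coefZ nth_default ?szM// !mulr0.
rewrite ltnNge; apply/negP => /leq_sizeP/(_ s (leqnn s))/eqP.
have coefM m : (m < s.+1)%N ->
    (('X - 1%:P) ^+ m * ('X - (-1)%:P) ^+ (s - m) : {poly R})`_s = 1.
  move=> ms; rewrite -[s in _`_s]/(s.+1.-1) -(szM m ms) -lead_coefE.
  apply/eqP; rewrite -[_ == _]/(_ \is monic).
  by rewrite monicMl monic_exp// monicXsubC.
(* The summand m = 0 contributes C(s+a, s) / 2^s > 0, the others are nonnegative. *)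
apply/negP; rewrite coef_sum big_ord_recl/= gt_eqF// ltr_pwDl//.
  rewrite E// !coefZ coefM// mulr1 mulr_gt0 ?exprn_gt0 ?invr_gt0//.
  by rewrite ltr0n muln_gt0 !bin_gt0 subn0 leq_addr.
apply: sumr_ge0 => m _; rewrite E ?lift0 ?ltnS ?ltn_ord//.
by rewrite !coefZ coefM ?lift0 ?ltnS ?ltn_ord// mulr1 mulr_ge0.
Qed.

(* No orthogonality is needed: jacobi s a b has exact degree s, so the Jacobi
   polynomials with s <= n span all polynomials of degree at most n. *)
Lemma bandlimited_mode (R : realType) (L : nat) (k k' : int) (q : {poly R}) :
  (maxn (absz k) (absz k') + size q <= L.+1)%N -> bandlimited L (mode k k' q).
Proof.
have [n] := ubnP (size q); elim: n q => // n IH q qn qL.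
have [->|q0] := eqVneq q 0; first by rewrite mode0; exact: bandlimited0.
set M := maxn _ _ in IH qL; pose s := (size q).-1.
have qs : size q = s.+1 by rewrite /s prednK// size_poly_gt0.
pose J := jacobi R s (absz (k - k')) (absz (k + k')).
have Js : size J = s.+1 by rewrite size_jacobi.
(* Taking l = s + M gives the Jacobi factor degree exactly s. *)
have [|c c0 cE] := @wignerD_mode R (s + M) k k' => //; first exact: leq_addl.
rewrite addnK -/J in cE.
have JL : bandlimited L (mode k k' J).
  rewrite (_ : mode _ _ _ = fun g => c^-1 * wignerD (s + M) k k' g).
    by apply/bandlimitedZ/bandlimited_wignerD; rewrite -/M; lia.
  by apply/funext => g; rewrite cE mulKf.
(* Subtracting this multiple of [J] cancels the leading term of [q], so the induction on the size
   applies to [r]. *)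
pose a := lead_coef q / lead_coef J; pose r := q - a *: J.
have -> : q = a *: J + r by rewrite /r addrC subrK.
rewrite (_ : mode _ _ _ = fun g => a%:C * mode k k' J g + mode k k' r g).
  have rs : (size r < size q)%N.
    rewrite qs ltnS; apply/leq_sizeP => j; rewrite leq_eqVlt => /predU1P[<-|sj].
      rewrite coefB coefZ /a !lead_coefE qs Js /= divfK ?subrr//.
      by rewrite -[s]/(s.+1.-1) -Js -lead_coefE lead_coef_eq0 -size_poly_gt0 Js.
    by rewrite coefB coefZ !nth_default ?qs ?Js// mulr0 subrr.
  apply: bandlimitedD; first exact: bandlimitedZ.
  by apply: IH; [lia|rewrite -/M; lia].
by apply/funext => g; rewrite modeD modeZ.
Qed.

(** * Products of band-limited functions *)

Lemma expi_addz (R : realType) (k m : int) (t : R) :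
  expi (- ((k + m)%:~R * t)) = expi (- (k%:~R * t)) * expi (- (m%:~R * t)).
Proof. by rewrite -expiD intrD mulrDl opprD. Qed.

(** By the triangle inequality and equal parities, |x| + |y| exceeds |x + y| by an even natural
    number. Surplus powers of sin(beta/2) and cos(beta/2) in a product are therefore whole
    squares. *)
Lemma absz_add_half (x y : int) :
  (absz x + absz y = absz (x + y)%R + 2 * (absz x + absz y - absz (x + y)%R)./2)%N.
Proof. lia. Qed.

Lemma maxn_absz (k k' : int) :
  (2 * maxn (absz k) (absz k') = absz (k - k')%R + absz (k + k')%R)%N.
Proof. lia. Qed.

(* Since |k-k'| + |k+k'| = 2 max(|k|,|k'|), the exponents of sin(beta/2) and
   cos(beta/2) that are absorbed into the polynomial balance the degrees. *)
Lemma bandlimited_modeM (R : realType) (L M : nat) (k k' m m' : int)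
    (q r : {poly R}) :
  (maxn (absz k) (absz k') + size q <= L.+1)%N ->
  (maxn (absz m) (absz m') + size r <= M.+1)%N ->
  bandlimited (L + M) (fun g => mode k k' q g * mode m m' r g).
Proof.
move=> qL rM.
(* For q = 0 the hypothesis still allows max(|k|,|k'|) = L + 1, so zero factors are kept out of the
   degree count. *)
have [q0|q0] := eqVneq q 0.
  rewrite (_ : (fun _ => _) = fun=> 0); first exact: bandlimited0.
  by apply/funext => g; rewrite q0 mode0 mul0r.
have [r0|r0] := eqVneq r 0.
  rewrite (_ : (fun _ => _) = fun=> 0); first exact: bandlimited0.
  by apply/funext => g; rewrite r0 mode0 mulr0.
have := absz_add_half (k - k') (m - m'); set i := (_./2)%N.
rewrite addrACA -opprD => iE.
have := absz_add_half (k + k') (m + m'); set j := (_./2)%N.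
rewrite addrACA => jE.
(* At cos beta, [A] and [B] take the values sin^2(beta/2) and cos^2(beta/2); their powers absorb the
   surplus squares. *)
pose A : {poly R} := 2^-1 *: (1 - 'X); pose B : {poly R} := 2^-1 *: (1 + 'X).
rewrite (_ : (fun _ => _) = mode (k + m) (k' + m') (q * r * (A ^+ i * B ^+ j))).
  apply: bandlimited_mode.
  have sA : (size A <= 2)%N.
    rewrite (leq_trans (size_scale_leq _ _))// -opprB size_polyN.
    by rewrite -polyC1 size_XsubC.
  have sB : (size B <= 2)%N.
    rewrite (leq_trans (size_scale_leq _ _))// addrC.
    by rewrite -polyC1 size_XaddC.
  have sX (P : {poly R}) n : (size P <= 2)%N -> (size (P ^+ n) <= n.+1)%N.
    move=> P2; apply: leq_trans (size_poly_exp_leq _ _) _.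
    by rewrite ltnS -[leqRHS]mul1n leq_mul2r -subn1 leq_subLR P2 orbT.
  have := sX A i sA; have := sX B j sB.
  have := size_polyMleq (A ^+ i) (B ^+ j).
  have := size_polyMleq (q * r) (A ^+ i * B ^+ j).
  have := size_polyMleq q r.
  (* With [iE] and [jE] this gives i + j = max(|k|,|k'|) + max(|m|,|m'|) - max(|k+m|,|k'+m'|), which
     balances the degrees. *)
  have := maxn_absz (k + m) (k' + m'); have := maxn_absz m m'.
  have := maxn_absz k k'; move: q0 r0; rewrite -!size_poly_gt0.
  move: (maxn _ _) (maxn _ _) (maxn _ _) qL rM iE jE => m1 m2 m3.
  move: (absz _) (absz _) (absz _) (absz _) (absz _) (absz _) => a1 a2 a3 a4 a5 a6.
  clearbody i j A B.
  lia.
apply/funext => g; rewrite /mode; set p := xget _ _.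
have AE t : A.[t] = 2^-1 * (1 - t) by rewrite !hornerE.
have BE t : B.[t] = 2^-1 * (1 + t) by rewrite !hornerE.
rewrite !expi_addz !hornerM !horner_exp AE BE.
set x := cos _; set u := Num.sqrt ((1 - x) / 2); set v := Num.sqrt ((1 + x) / 2).
have -> : 2^-1 * (1 - x) = u ^+ 2 by rewrite sqr_sqrtr ?half1Bcos_ge0// mulrC.
have -> : 2^-1 * (1 + x) = v ^+ 2 by rewrite sqr_sqrtr ?half1Dcos_ge0// mulrC.
set e1 := expi _; set e2 := expi _; set e3 := expi _; set e4 := expi _.
transitivity (e1 * e3 * (e2 * e4) * ((u ^+ (absz (k - k')%R + absz (m - m')%R)
   * v ^+ (absz (k + k')%R + absz (m + m')%R) * (q.[x] * r.[x]))%:C)).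
  by rewrite !exprD !rmorphM/=; ring.
by rewrite iE jE (exprD u) (exprD v) !exprM !rmorphM/=; ring.
Qed.

(** Two span inductions, one per factor, leave a product of two Wigner functions, which up to
    scalars are modes. *)
Lemma bandlimitedM (R : realType) (L M : nat) (f h : SO3 R -> R[i]) :
  bandlimited L f -> bandlimited M h ->
  bandlimited (L + M) (fun g => f g * h g).
Proof.
move=> fL hM; elim/bandlimited_ind: f / fL => [|f f' fh fh'|a f fh|l k k' kl].
- by under eq_fun do rewrite mul0r; exact: bandlimited0.
- by under eq_fun do rewrite mulrDl; exact: bandlimitedD.
- by under eq_fun do rewrite -mulrA; exact: bandlimitedZ.
elim/bandlimited_ind: h / hM => [|h h' fh fh'|a h fh|n m m' mn].
- by under eq_fun do rewrite mulr0; exact: bandlimited0.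
- by under eq_fun do rewrite mulrDr; exact: bandlimitedD.
- by under eq_fun do rewrite mulrCA; exact: bandlimitedZ.
have /andP[kl1 lL] := kl; have /andP[mn1 nM] := mn.
have [c _ cE] := @wignerD_mode R _ _ _ kl1.
have [d _ dE] := @wignerD_mode R _ _ _ mn1.
under eq_fun do rewrite cE dE mulrACA.
by apply/bandlimitedZ/bandlimited_modeM; rewrite size_jacobi; lia.
Qed.

(** * Transfer to real-valued functions *)

Lemma bandlimited_realD (R : realType) (L : nat) (f h : SO3 R -> R) :
  bandlimited_real L f -> bandlimited_real L h ->
  bandlimited_real L (fun g => f g + h g).
Proof.
rewrite /bandlimited_real; under [X in _ -> _ -> bandlimited _ X]eq_fun do rewrite rmorphD.
exact: bandlimitedD.
Qed.

Lemma bandlimited_realZ (R : realType) (L : nat) (a : R) (f : SO3 R -> R) :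
  bandlimited_real L f -> bandlimited_real L (fun g => a * f g).
Proof.
rewrite /bandlimited_real; under [X in _ -> bandlimited _ X]eq_fun do rewrite rmorphM.
exact: bandlimitedZ.
Qed.

Lemma bandlimited_realM (R : realType) (L M : nat) (f h : SO3 R -> R) :
  bandlimited_real L f -> bandlimited_real M h ->
  bandlimited_real (L + M) (fun g => f g * h g).
Proof.
rewrite /bandlimited_real; under [X in _ -> _ -> bandlimited _ X]eq_fun do rewrite rmorphM.
exact: bandlimitedM.
Qed.

Lemma Re_mode (R : realType) (k k' : int) (q : {poly R}) (g : SO3 R) :
  let p := xget (0, 0, 0) (is_euler_angles g) in
  complex.Re (mode k k' q g) = cos (k%:~R * p.1.1 + k'%:~R * p.2)
  * (Num.sqrt ((1 - cos p.1.2) / 2) ^+ absz (k - k')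
     * Num.sqrt ((1 + cos p.1.2) / 2) ^+ absz (k + k') * q.[cos p.1.2]).
Proof. by move=> p; rewrite /mode -/p -expiD -opprD /expi/= mulr0 subr0 cosN. Qed.

Lemma Im_mode (R : realType) (k k' : int) (q : {poly R}) (g : SO3 R) :
  let p := xget (0, 0, 0) (is_euler_angles g) in
  complex.Im (mode k k' q g) = - sin (k%:~R * p.1.1 + k'%:~R * p.2)
  * (Num.sqrt ((1 - cos p.1.2) / 2) ^+ absz (k - k')
     * Num.sqrt ((1 + cos p.1.2) / 2) ^+ absz (k + k') * q.[cos p.1.2]).
Proof.
by move=> p; rewrite /mode -/p -expiD -opprD /expi/= mulr0 add0r sinN.
Qed.

(** Negating both indices conjugates the phases and keeps |k - k'| and |k + k'|. *)
Lemma mode_conj (R : realType) (k k' : int) (q : {poly R}) (g : SO3 R) :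
  mode (- k) (- k') q g = conjc (mode k k' q g).
Proof.
apply/eqP; rewrite eq_complex; apply/andP; split; apply/eqP.
  rewrite [RHS](_ : _ = complex.Re (mode k k' q g)); last by case: mode.
  by rewrite !Re_mode/= -!opprD !abszN !mulrNz !mulNr -opprD cosN.
rewrite [RHS](_ : _ = - complex.Im (mode k k' q g)); last by case: mode.
by rewrite !Im_mode/= -!opprD !abszN !mulrNz !mulNr -opprD sinN opprK mulNr opprK.
Qed.

(** Re z = (z + conj z) / 2, and the conjugate is a mode with the same max(|k|,|k'|) and the same
    polynomial. *)
Lemma bandlimited_Re_mode (R : realType) (L : nat) (k k' : int) (q : {poly R}) :
  (maxn (absz k) (absz k') + size q <= L.+1)%N ->
  bandlimited_real L (fun g => complex.Re (mode k k' q g)).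
Proof.
move=> qL; rewrite /bandlimited_real [X in bandlimited L X](_ : _ =
    fun g => (2^-1)%:C * (mode k k' q g + mode (- k) (- k') q g)).
  by apply/bandlimitedZ/bandlimitedD; apply: bandlimited_mode; rewrite ?abszN.
apply/funext => g; rewrite mode_conj; case: mode => x y.
by apply/eqP; rewrite eq_complex/=; apply/andP; split; apply/eqP; field.
Qed.

Lemma bandlimited_Im_mode (R : realType) (L : nat) (k k' : int) (q : {poly R}) :
  (maxn (absz k) (absz k') + size q <= L.+1)%N ->
  bandlimited_real L (fun g => complex.Im (mode k k' q g)).
Proof.
move=> qL; rewrite /bandlimited_real [X in bandlimited L X](_ : _ =
    (* The scalar is 1/(2i), from Im z = (z - conj z) / (2i). *)
    fun g => (0 +i* (- 2^-1)) * (mode k k' q g + (-1) * mode (- k) (- k') q g)).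
  apply/bandlimitedZ/bandlimitedD; first exact: bandlimited_mode.
  by apply/bandlimitedZ/bandlimited_mode; rewrite !abszN.
apply/funext => g; rewrite mode_conj; case: mode => x y.
by apply/eqP; rewrite eq_complex/=; apply/andP; split; apply/eqP; field.
Qed.

(** * Entries of a rotation as 1-band-limited functions *)

Lemma SO3_modeE (R : realType) (g : SO3 R) :
  let re k k' q := complex.Re (mode k k' q g) in
  let im k k' q := complex.Im (mode k k' q g) in
  (* Half-angle form of the Euler-angle matrix: cos^2(beta/2) goes with alpha + gamma, sin^2(beta/2)
     with alpha - gamma, and sin beta = 2 sin(beta/2) cos(beta/2) with a single angle. Since the
     phases are e^{-i(...)}, [im] carries minus a sine. *)
  SO3_mx g = mx_of_seq
    [:: [:: re 1 1 1 + -1 * re 1 (-1) 1; im 1 1 1 + im 1 (-1) 1; 2 * re 1 0 1];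
        [:: -1 * im 1 1 1 + im 1 (-1) 1; re 1 1 1 + re 1 (-1) 1; -2 * im 1 0 1];
        [:: -2 * re 0 1 1; -2 * im 0 1 1; re 0 0 'X]].
Proof.
move=> re im; rewrite /re /im !Re_mode !Im_mode; cbv zeta.
have := xgetPex (0, 0, 0) (is_euler_angles_ex g).
case: xget => -[a b] c [/= hb ->]; rewrite eulerE.
rewrite !hornerE /= !(mulr0z, mulr1z, mulrN1z, mul0r, mul1r, mulN1r, addr0, add0r).
set u := Num.sqrt ((1 - cos b) / 2); set v := Num.sqrt ((1 + cos b) / 2).
have u2 : u ^+ 2 = (1 - cos b) / 2 by rewrite sqr_sqrtr ?half1Bcos_ge0.
have v2 : v ^+ 2 = (1 + cos b) / 2 by rewrite sqr_sqrtr ?half1Dcos_ge0.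
have sb : sin b = 2 * (u * v).
  (* Both sides are nonnegative for 0 <= beta <= pi, so it suffices to compare squares. *)
  apply/eqP; rewrite -(@eqrXn2 _ 2)// ?sin_ge0_pi ?mulr_ge0 ?sqrtr_ge0//.
  by rewrite !exprMn u2 v2 sin2cos2; apply/eqP; field.
have uu z : z * u * u = z * ((1 - cos b) / 2) by rewrite -u2 -mulrA.
have vv z : z * v * v = z * ((1 + cos b) / 2) by rewrite -v2 -mulrA.
rewrite !uu !vv sb cosB cosD sinB sinD cos0.
by apply/matrixP; case=> [[|[|[|//]]] ?] [[|[|[|//]]] ?]; rewrite !mxE/=; field.
Qed.

(** Each mode in the table has max(|k|,|k'|) + size q <= 2; for the entry cos beta, k = k' = 0 and q
    has degree one. *)
Lemma bandlimited_entry (R : realType) (i j : 'I_3) :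
  bandlimited_real 1 (fun g : SO3 R => g i j).
Proof.
under eq_fun do rewrite SO3_modeE mxE.
case: i j => [[|[|[|//]]] ?] [[|[|[|//]]] ?] /=;
  repeat first [apply: bandlimited_Re_mode | apply: bandlimited_Im_mode
    | apply: bandlimited_realZ | apply: bandlimited_realD];
  by rewrite ?size_poly1 ?size_polyX.
Qed.

Theorem lemma4p1 (R : realType) (L : nat) (F : SO3 R -> 'M[R]_3)
    (Flx Fly Flz Frx Fry Frz : SO3 R -> R)
    (hF : vector_field F)
    (hl : forall g, F g = Flx g *: dL_x g + Fly g *: dL_y g + Flz g *: dL_z g)
    (hr : forall g, F g = Frx g *: dR_x g + Fry g *: dR_y g + Frz g *: dR_z g) :
  (bandlimited_real L Flx /\ bandlimited_real L Fly /\ bandlimited_real L Flz ->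
   bandlimited_real L.+1 Frx /\ bandlimited_real L.+1 Fry
     /\ bandlimited_real L.+1 Frz) /\
  (bandlimited_real L Frx /\ bandlimited_real L Fry /\ bandlimited_real L Frz ->
   bandlimited_real L.+1 Flx /\ bandlimited_real L.+1 Fly
     /\ bandlimited_real L.+1 Flz).
Proof.
pose vl g : 'cV[R]_3 := \col_i nth 0 [:: Flx g; Fly g; Flz g] i.
pose vr g : 'cV[R]_3 := \col_i nth 0 [:: Frx g; Fry g; Frz g] i.
have lr g : vl g = g^T *m vr g.
  apply: frame_change; transitivity (F g).
    rewrite hl /dL_x /dL_y /dL_z !scalemxAr -!mulmxDr.
    by rewrite /hat !mxE !inordK.
  rewrite hr /dR_x /dR_y /dR_z !scalemxAl -!mulmxDl.
  by rewrite /hat !mxE !inordK.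
(* Orthogonality inverts the relation, so each family of components is a combination of the other
   with entries of g as coefficients. *)
have rl g : vr g = g *m vl g by rewrite lr mulmxA SO3_trmxK mul1mx.
have comb (f : SO3 R -> 'cV[R]_3) (M : 'I_3 -> SO3 R -> R) :
    (forall j, bandlimited_real 1 (M j)) ->
    (forall j, bandlimited_real L (fun g => f g j 0)) ->
    bandlimited_real L.+1 (fun g => \sum_j M j g * f g j 0).
  move=> MB fB; under eq_fun do rewrite sum3E.
  (* Each term is an entry of band 1 times a component of band L. *)
  rewrite -add1n; do !apply: bandlimited_realD; exact: bandlimited_realM.
have coord (x y z : SO3 R -> R) (n : nat) :
    let v g : 'cV[R]_3 := \col_i nth 0 [:: x g; y g; z g] i in
    (forall j, bandlimited_real n (fun g => v g j 0)) <->
    bandlimited_real n x /\ bandlimited_real n y /\ bandlimited_real n z.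
  split=> [h|[hx [hy hz]]].
    have H i := h (inord i).
    by split; [move: (H 0)|split; [move: (H 1)|move: (H 2)]];
       under eq_fun do rewrite !mxE inordK//.
  by case=> [[|[|[|//]]] ?]; under eq_fun do rewrite !mxE/=.
split=> /coord h; apply/coord => i.
  rewrite (_ : (fun g => _) = fun g : SO3 R => \sum_j g i j * vl g j 0).
    by apply: comb => // j; exact: bandlimited_entry.
  by apply/funext => g; rewrite -/(vr g) rl mxE.
(* The converse uses g^T, hence the exchanged indices in [g j i]. *)
rewrite (_ : (fun g => _) = fun g : SO3 R => \sum_j g j i * vr g j 0).
  by apply: comb => // j; exact: bandlimited_entry.
by apply/funext => g; rewrite -/(vl g) lr mxE; apply: eq_bigr => j _; rewrite mxE.
Qed.
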